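(* Let $\mathcal S\colon\mathtt C\to\mathtt{FVec}$ be a stem, let $c,d\in\mathtt C$, let $X$ be a finite-dimensional real vector space, let $\mathcal G$ be an $\mathcal S$-system on $X$ and let the linear map $\Theta\colon X\to\mathcal S(c)$ be a concrete realization of $\mathcal G$ on $\mathcal A_c$ (that is, $\mathcal G=\Theta^{-1}(\mathcal A_c)$). Further assume that either $\Theta$ is onto, or that the image of $\Theta$ meets the interior of $A(c)$ and $A(d)$ is sharp. Then for every $\Psi\in\mathrm{CP}(\mathcal G,\mathcal A_d)$ there exists $\Phi\in\mathrm{CP}(\mathcal A_c,\mathcal A_d)$ with $\Psi=\Phi\circ\Theta$.
   Context: All vector spaces are finite-dimensional and real; $\mathtt{FVec}$ is the category of these with linear maps, $\mathrm{Lin}(V,W)$ is the space of linear maps, $V'=\mathrm{Lin}(V,\mathbb R)$. A convex cone $C$ is sharp if $C\cap -C=\{0\}$. A star autonomous category is a symmetric monoidal category $(\mathtt C,\otimes,\mathbf 1)$ with a full and faithful functor ${}^*\colon\mathtt C^{\mathrm{op}}\to\mathtt C$ and a natural bijection $\mathtt C(a\otimes b,c)\cong\mathtt C(a,(b\otimes c^* )^* )$. $\mathtt{FVec}$ is star autonomous with the usual tensor product and dual. A stem is a star autonomous functor $\mathcal S\colon\mathtt C\to\mathtt{FVec}$, where $\mathtt C$ is star autonomous: i.e. a strong monoidal functor with natural isomorphisms $\mathcal S(c^* )\cong\mathcal S(c)'$, such that $\mathcal S$ carries the bijection $\mathtt C(a\otimes b,c)\cong\mathtt C(a,(b\otimes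 c^* )^* )$ to the corresponding bijection in $\mathtt{FVec}$. These isomorphisms are written as equalities: $\mathcal S(\mathbf 1)=\mathbb R$, $\mathcal S(\mathbf 1^* )=\mathbb R'=\mathbb R$, $\mathcal S(c\otimes d)=\mathcal S(c)\otimes\mathcal S(d)$, $\mathcal S(c^* )=\mathcal S(c)'$. For $c\in\mathtt C$: $A(c)=\{v\in\mathcal S(c)\mid\mathcal S(\varphi)(v)\ge 0\ \forall\varphi\in\mathtt C(c,\mathbf 1^* )\}$. An $\mathcal S$-system $\mathcal G$ on $X$ is a family of closed convex cones $\mathcal G(c)\subseteq X\otimes\mathcal S(c)$, $c\in\mathtt C$, with $(\mathrm{id}_X\otimes\mathcal S(\Phi))(\mathcal G(c))\subseteq\mathcal G(d)$ for all $\Phi\in\mathtt C(c,d)$. For $\mathcal S$-systems $\mathcal G$ on $X$ and $\mathcal E$ on $Y$, $\mathrm{CP}(\mathcal G,\mathcal E)$ is the set of $\Psi\in\mathrm{Lin}(X,Y)$ with $(\Psi\otimes\mathrm{id}_{\mathcal S(e)})(\mathcal G(e))\subseteq\mathcal E(e)$ for all $e\in\mathtt C$. The intrinsic system $\mathcal A_d$ on $\mathcal S(d)$ is $\mathcal A_d(e)=A(d\otimes e)\subseteq\mathcal S(d)\otimes\mathcal S(e)$. For linear $\Theta\colon X\to\mathcal S(c)$, $\Theta^{-1}(\mathcal A_c)$ is the $\mathcal S$-system on $X$ with $(\Theta^{-1}(\mathcal A_c))(e)=(\Theta\otimes\mathrm{id}_{\mathcal S(e)})^{-1}(A(c\otimes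 e))$. *)

(* Defs.v *)
From HB Require Import structures.
From mathcomp Require Import all_boot all_order all_algebra.
From mathcomp Require Import all_classical all_reals all_analysis.

Set Implicit Arguments.
Unset Strict Implicit.
Unset Printing Implicit Defensive.

Import Order.TTheory GRing.Theory Num.Theory.
Import numFieldNormedType.Exports.

Local Open Scope ring_scope.
Local Open Scope classical_set_scope.

Declare Scope cat_scope.
Delimit Scope cat_scope with cat.

Reserved Notation "g \oc f" (at level 50, left associativity).
Reserved Notation "a \ox b" (at level 40, left associativity).
Reserved Notation "f \ot g" (at level 40, left associativity).

Record category := Category {
  ob :> Type;
  hom : ob -> ob -> Type;
  idc : forall a, hom a a;
  compc : forall a b c, hom b c -> hom a b -> hom a c;
  compcA : forall a b c d (h : hom c d) (g : hom b c) (f : hom a b),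
    compc h (compc g f) = compc (compc h g) f;
  comp1c : forall a b (f : hom a b), compc (idc b) f = f;
  compc1 : forall a b (f : hom a b), compc f (idc a) = f }.

Arguments hom {_} _ _.
Arguments idc {_} a.
Arguments compc {_ a b c} _ _.
Notation "g \oc f" := (compc g f) : cat_scope.
Local Open Scope cat_scope.

Definition is_iso (C : category) (a b : C) (f : hom a b) : Prop :=
  exists g : hom b a, g \oc f = idc a /\ f \oc g = idc b.

Record sym_monoidal := SymMonoidal {
  sm_cat :> category;
  otimes : sm_cat -> sm_cat -> sm_cat;
  unit1 : sm_cat;
  otimesh : forall a b a' b' : sm_cat,
    hom a a' -> hom b b' -> hom (otimes a b) (otimes a' b');
  associ : forall a b c : sm_cat,
    hom (otimes (otimes a b) c) (otimes a (otimes b c));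
  lunit : forall a : sm_cat, hom (otimes unit1 a) a;
  runit : forall a : sm_cat, hom (otimes a unit1) a;
  braid : forall a b : sm_cat, hom (otimes a b) (otimes b a);
  otimesh_id : forall a b, otimesh (idc a) (idc b) = idc (otimes a b);
  otimesh_comp : forall a b a' b' a'' b''
      (f' : hom a' a'') (f : hom a a') (g' : hom b' b'') (g : hom b b'),
    otimesh (f' \oc f) (g' \oc g) = otimesh f' g' \oc otimesh f g;
  assoc_nat : forall a b c a' b' c'
      (f : hom a a') (g : hom b b') (h : hom c c'),
    associ a' b' c' \oc otimesh (otimesh f g) h =
    otimesh f (otimesh g h) \oc associ a b c;
  lunit_nat : forall a a' (f : hom a a'),
    lunit a' \oc otimesh (idc unit1) f = f \oc lunit a;
  runit_nat : forall a a' (f : hom a a'),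
    runit a' \oc otimesh f (idc unit1) = f \oc runit a;
  braid_nat : forall a b a' b' (f : hom a a') (g : hom b b'),
    braid a' b' \oc otimesh f g = otimesh g f \oc braid a b;
  assoc_iso : forall a b c, is_iso (associ a b c);
  lunit_iso : forall a, is_iso (lunit a);
  runit_iso : forall a, is_iso (runit a);
  pentagon : forall a b c d,
    associ a b (otimes c d) \oc associ (otimes a b) c d =
    otimesh (idc a) (associ b c d) \oc associ a (otimes b c) d
      \oc otimesh (associ a b c) (idc d);
  triangle : forall a b,
    otimesh (idc a) (lunit b) \oc associ a unit1 b =
    otimesh (runit a) (idc b);
  hexagon : forall a b c,
    associ b c a \oc braid a (otimes b c) \oc associ a b c =
    otimesh (idc b) (braid a c) \oc associ b a c
      \oc otimesh (braid a b) (idc c);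
  braid_sym : forall a b, braid b a \oc braid a b = idc (otimes a b) }.

Arguments otimes {_} _ _.
Arguments unit1 {_}.
Arguments otimesh {_ a b a' b'} _ _.
Arguments associ {_} a b c.
Arguments lunit {_} a.
Arguments runit {_} a.
Arguments braid {_} a b.
Notation "a \ox b" := (otimes a b) : cat_scope.
Notation "f \ot g" := (otimesh f g) : cat_scope.

Record star_autonomous := StarAutonomous {
  sa_sm :> sym_monoidal;
  star : sa_sm -> sa_sm;
  starh : forall a b : sa_sm, hom a b -> hom (star b) (star a);
  starh_id : forall a, starh (idc a) = idc (star a);
  starh_comp : forall a b c (g : hom b c) (f : hom a b),
    starh (g \oc f) = starh f \oc starh g;
  starh_bij : forall a b, bijective (@starh a b);
  scurry : forall a b c : sa_sm,
    hom (a \ox b) c -> hom a (star (b \ox star c));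
  scurry_bij : forall a b c, bijective (@scurry a b c);
  scurry_nat : forall (a b c a' b' c' : sa_sm)
      (f : hom a' a) (g : hom b' b) (h : hom c c') (phi : hom (a \ox b) c),
    scurry (h \oc phi \oc (f \ot g)) =
    starh (g \ot starh h) \oc scurry phi \oc f }.

Arguments star {_} _.
Arguments starh {_ a b} _.
Arguments scurry {_ a b c} _.

(* [fstar_scurry] is the commutative square expressing that F carries [scurry]
   in C to [scurry] in D modulo [fmu] and [fstar]; it is an equation in
   hom (F a) (star (F b \ox F (star c))). *)
Record star_functor (C D : star_autonomous) := StarFunctor {
  fobj :> C -> D;
  fmap : forall a b : C, hom a b -> hom (fobj a) (fobj b);
  fmap_id : forall a, fmap (idc a) = idc (fobj a);
  fmap_comp : forall (a b c : C) (g : hom b c) (f : hom a b),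
    fmap (g \oc f) = fmap g \oc fmap f;
  fmu : forall a b : C, hom (fobj a \ox fobj b) (fobj (a \ox b));
  feps : hom unit1 (fobj unit1);
  fmu_nat : forall (a b a' b' : C) (f : hom a a') (g : hom b b'),
    fmu a' b' \oc (fmap f \ot fmap g) = fmap (f \ot g) \oc fmu a b;
  fmu_iso : forall a b, is_iso (fmu a b);
  feps_iso : is_iso feps;
  fmu_assoc : forall a b c : C,
    fmap (associ a b c) \oc fmu (a \ox b) c \oc (fmu a b \ot idc (fobj c)) =
    fmu a (b \ox c) \oc (idc (fobj a) \ot fmu b c)
      \oc associ (fobj a) (fobj b) (fobj c);
  fmu_lunit : forall a : C,
    fmap (lunit a) \oc fmu unit1 a \oc (feps \ot idc (fobj a)) =
    lunit (fobj a);
  fmu_runit : forall a : C,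
    fmap (runit a) \oc fmu a unit1 \oc (idc (fobj a) \ot feps) =
    runit (fobj a);
  fstar : forall a : C, hom (fobj (star a)) (star (fobj a));
  fstar_nat : forall (a b : C) (f : hom a b),
    fstar a \oc fmap (starh f) = starh (fmap f) \oc fstar b;
  fstar_iso : forall a, is_iso (fstar a);
  fstar_scurry : forall (a b c : C) (phi : hom (a \ox b) c),
    starh (fmu b (star c)) \oc fstar (b \ox star c) \oc fmap (scurry phi) =
    starh (idc (fobj b) \ot fstar c) \oc scurry (fmap phi \oc fmu a b) }.

Arguments fmap {C D} _ {a b} _.
Arguments fmu {C D} _ a b.
Arguments feps {C D} _.
Arguments fstar {C D} _ a.

Section Tensor.
Variable K : fieldType.
Implicit Types T U V W Z : vectType K.

Definition dualv V : vectType K := 'Hom(V, K^o).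

Definition dualmap V W (f : 'Hom(V, W)) : 'Hom(dualv W, dualv V) :=
  linfun (fun phi : dualv W => (phi \o f)%VF : dualv V).

(* In finite dimension V \otimes W is Lin(V', W), with v \otimes w acting as
   phi |-> phi(v) w; [tens_liftE] and [tens_ext] are its universal property. *)
Definition tens V W : vectType K := 'Hom(dualv V, W).

Definition pure V W (v : V) (w : W) : tens V W :=
  linfun (fun phi : dualv V => (phi v : K) *: w).

Definition bilin V W U (b : V -> W -> U) : Prop :=
  (forall v, linear (b v)) /\ (forall w, linear (b ^~ w)).

Definition dualb V (i : 'I_(\dim {:V})) : dualv V :=
  linfun (coord (vbasis {:V}) i : V -> K^o).

Definition tens_lift V W U (b : V -> W -> U) : 'Hom(tens V W, U) :=
  linfun (fun t : tens V W => \sum_(i < \dim {:V}) b (vbasis {:V})`_i (t (dualb i))).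

Definition tens_map V W V' W' (f : 'Hom(V, V')) (g : 'Hom(W, W')) :
    'Hom(tens V W, tens V' W') :=
  tens_lift (fun v w => pure (f v) (g w)).

Definition tens_assoc U V W : 'Hom(tens (tens U V) W, tens U (tens V W)) :=
  tens_lift (fun t w => tens_lift (fun u v => pure u (pure v w)) t).

Definition tens_lunit V : 'Hom(tens K^o V, V) :=
  tens_lift (fun (k : K^o) v => (k : K) *: v).

Definition tens_runit V : 'Hom(tens V K^o, V) :=
  tens_lift (fun v (k : K^o) => (k : K) *: v).

Definition tens_braid V W : 'Hom(tens V W, tens W V) :=
  tens_lift (fun v w => pure w v).

(* f : V \otimes W -> U is sent to v |-> (w \otimes phi |-> phi (f (v \otimes w))) *)
Definition tens_curry V W U (f : 'Hom(tens V W, U)) :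
    'Hom(V, dualv (tens W (dualv U))) :=
  linfun (fun v : V =>
    tens_lift (fun w (phi : dualv U) => phi (f (pure v w))) :
      dualv (tens W (dualv U))).

Lemma linfunE V W (f : V -> W) : linear f -> linfun f =1 f.
Proof.
move=> fl; pose F := GRing.isLinear.Build K V W _ f fl.
pose g : {linear V -> W} := HB.pack f F.
exact: (lfunE g).
Qed.

Lemma dualmapE V W (f : 'Hom(V, W)) phi v : dualmap f phi v = phi (f v).
Proof.
rewrite linfunE ?comp_lfunE // => k p q.
by apply/lfunP=> x; rewrite !(comp_lfunE, add_lfunE, scale_lfunE).
Qed.

Lemma pureE V W (v : V) (w : W) phi : pure v w phi = (phi v : K) *: w.
Proof.
rewrite linfunE // => k p q.
by rewrite !(add_lfunE, scale_lfunE) scalerDl scalerA.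
Qed.

Lemma pure_bilin V W : bilin (@pure V W).
Proof.
split=> [v k x y|w k x y]; apply/lfunP=> phi;
  rewrite !(add_lfunE, scale_lfunE, pureE).
  by rewrite scalerDr !scalerA mulrC.
by rewrite linearP scalerDl scalerA.
Qed.

Lemma dualbE V (v : V) : v = \sum_(i < \dim {:V}) (dualb i v : K) *: (vbasis {:V})`_i.
Proof.
rewrite {1}(coord_vbasis (memvf v)); apply: eq_bigr => i _.
by rewrite linfunE // => k x y; rewrite linearP.
Qed.

Lemma dualb_sum V (phi : dualv V) :
  phi = \sum_(i < \dim {:V}) (phi (vbasis {:V})`_i : K) *: dualb i.
Proof.
apply/lfunP=> v; rewrite {1}[v]dualbE linear_sum sum_lfunE; apply: eq_bigr => i _.
by rewrite linearZ scale_lfunE /= /GRing.scale /= mulrC.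
Qed.

Lemma tens_lift_linear V W U (b : V -> W -> U) : bilin b ->
  linear (fun t : tens V W => \sum_(i < \dim {:V}) b (vbasis {:V})`_i (t (dualb i))).
Proof.
move=> [bl _] k s t; rewrite scaler_sumr -big_split /=; apply: eq_bigr => i _.
by rewrite add_lfunE scale_lfunE bl.
Qed.

Lemma tens_liftS V W U (b : V -> W -> U) : bilin b -> forall t,
  tens_lift b t = \sum_(i < \dim {:V}) b (vbasis {:V})`_i (t (dualb i)).
Proof. by move=> bb t; rewrite linfunE //; apply: tens_lift_linear. Qed.

Lemma linear_scale V W (f : V -> W) : linear f -> forall k v, f (k *: v) = k *: f v.
Proof. by move=> fl k v; have E := linfunE fl; rewrite -!E linearZ. Qed.

Lemma linear_bigsum V W (f : V -> W) I (r : seq I) (g : I -> V) :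
  linear f -> f (\sum_(i <- r) g i) = \sum_(i <- r) f (g i).
Proof.
move=> fl; have E := linfunE fl; rewrite -E linear_sum.
by apply: eq_bigr => i _ /=; rewrite E.
Qed.

Lemma tens_liftE V W U (b : V -> W -> U) : bilin b -> forall v w,
  tens_lift b (pure v w) = b v w.
Proof.
move=> bb v w; rewrite tens_liftS // {2}[v]dualbE.
case: bb => bl br; rewrite (linear_bigsum _ _ (br w)); apply: eq_bigr => i _.
by rewrite pureE (linear_scale (bl _)) (linear_scale (br _)).
Qed.

Lemma tens_sum V W (t : tens V W) : t = \sum_(i < \dim {:V}) pure (vbasis {:V})`_i (t (dualb i)).
Proof.
apply/lfunP=> phi; rewrite {1}[phi]dualb_sum linear_sum sum_lfunE.
by apply: eq_bigr => i _; rewrite linearZ pureE.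
Qed.

Lemma tens_ext V W U (f g : 'Hom(tens V W, U)) :
  (forall v w, f (pure v w) = g (pure v w)) -> f = g.
Proof.
move=> fg; apply/lfunP=> t; rewrite [t]tens_sum !linear_sum.
by apply: eq_bigr => i _ /=; rewrite fg.
Qed.

Lemma tens_lift_paramP V W U Z (b : Z -> V -> W -> U) :
    (forall z, bilin (b z)) -> (forall v w, linear (fun z => b z v w)) ->
  forall t, linear (fun z => tens_lift (b z) t).
Proof.
move=> bb bl t k x y; rewrite !tens_liftS // scaler_sumr -big_split /=.
by apply: eq_bigr => i _; rewrite bl.
Qed.

Lemma tens_mapE V W V' W' (f : 'Hom(V, V')) (g : 'Hom(W, W')) v w :
  tens_map f g (pure v w) = pure (f v) (g w).
Proof.
have [pl pr] := @pure_bilin V' W'.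
by rewrite tens_liftE //; split=> [x|y] k p q; rewrite linearP (pl, pr).
Qed.

Lemma tens_assocE U V W (u : U) (v : V) (w : W) :
  tens_assoc U V W (pure (pure u v) w) = pure u (pure v w).
Proof.
have [pl pr] := @pure_bilin U (tens V W); have [ql qr] := @pure_bilin V W.
have bb z : bilin (fun (u : U) (v : V) => pure u (pure v z) : tens U (tens V W)).
  by split=> [x|y] k p q; rewrite ?qr (pl, pr).
rewrite tens_liftE ?tens_liftE //; split=> [t|z].
  by apply: tens_lift_paramP => // x y k p q; rewrite ql pl.
by move=> k p q; rewrite linearP.
Qed.

Lemma tens_lunitE V k (v : V) : tens_lunit V (pure (k : K^o) v) = k *: v.
Proof.
rewrite tens_liftE //; split=> [x|y] l p q; first by rewrite scalerDr !scalerA mulrC.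
by rewrite scalerDl scalerA.
Qed.

Lemma tens_runitE V k (v : V) : tens_runit V (pure v (k : K^o)) = k *: v.
Proof.
rewrite tens_liftE //; split=> [x|y] l p q; last by rewrite scalerDr !scalerA mulrC.
by rewrite scalerDl scalerA.
Qed.

Lemma tens_braidE V W (v : V) (w : W) : tens_braid V W (pure v w) = pure w v.
Proof.
have [pl pr] := @pure_bilin W V.
by rewrite tens_liftE //; split=> [x|y] k p q; rewrite (pl, pr).
Qed.

Lemma tens_curryE V W U (f : 'Hom(tens V W, U)) v w (phi : dualv U) :
  tens_curry f v (pure w phi) = phi (f (pure v w)).
Proof.
have [pl pr] := @pure_bilin V W.
have bb z : bilin (fun w (phi : dualv U) => phi (f (pure z w))).
  split=> [x|y] k p q; first by rewrite add_lfunE scale_lfunE.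
  by rewrite pl !linearP.
rewrite linfunE ?tens_liftE // => k p q; apply/lfunP=> t.
rewrite add_lfunE scale_lfunE.
apply: (tens_lift_paramP (b := fun z w (phi : dualv U) => phi (f (pure z w)))) => //.
by move=> x y l r s; rewrite pr !linearP.
Qed.

Lemma dualmap_bij V W : bijective (@dualmap V W).
Proof.
pose h (g : 'Hom(dualv W, dualv V)) : 'Hom(V, W) :=
  linfun (fun v => \sum_(i < \dim {:W}) (g (dualb i) v : K) *: (vbasis {:W})`_i).
have hE g v : h g v = \sum_(i < \dim {:W}) (g (dualb i) v : K) *: (vbasis {:W})`_i.
  rewrite linfunE // => k p q; rewrite scaler_sumr -big_split /=.
  by apply: eq_bigr => i _; rewrite linearP scalerDl scalerA.
exists h => [f|g].
  apply/lfunP=> v; rewrite hE [RHS]dualbE.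
  by apply: eq_bigr => i _; rewrite dualmapE.
apply/lfunP=> phi; apply/lfunP=> v; rewrite dualmapE hE linear_sum.
rewrite {2}[phi]dualb_sum linear_sum sum_lfunE; apply: eq_bigr => i _.
by rewrite !linearZ scale_lfunE /= /GRing.scale /= mulrC.
Qed.

Lemma tens_curry_bij V W U : bijective (@tens_curry V W U).
Proof.
have [pl pr] := @pure_bilin W (dualv U).
pose b (g : 'Hom(V, dualv (tens W (dualv U)))) v w :=
  \sum_(i < \dim {:U}) (g v (pure w (dualb i)) : K) *: (vbasis {:U})`_i.
have bb g : bilin (b g).
  split=> [v|w] k p q; rewrite /b scaler_sumr -big_split /=;
    apply: eq_bigr => i _; rewrite scalerA -scalerDl; congr (_ *: _).
    by rewrite pr linearP.
  by rewrite linearP add_lfunE scale_lfunE.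
exists (fun g => tens_lift (b g)) => [f|g].
  apply: tens_ext => v w; rewrite tens_liftE // [RHS]dualbE.
  by apply: eq_bigr => i _; rewrite tens_curryE.
apply/lfunP=> v; apply: tens_ext => w phi; rewrite tens_curryE tens_liftE //.
rewrite linear_sum {2}[phi]dualb_sum (linear_bigsum _ _ (pl w)) linear_sum.
apply: eq_bigr => i _.
by rewrite (linear_scale (pl w)) !linearZ /= /GRing.scale /= mulrC.
Qed.

Lemma pure_linl V W (w : W) : linear (fun v : V => pure v w).
Proof. exact: (@pure_bilin V W).2. Qed.

Lemma pure_linr V W (v : V) : linear (fun w : W => pure v w).
Proof. exact: (@pure_bilin V W).1. Qed.

Lemma tens_ext3 U V W Z (f g : 'Hom(tens (tens U V) W, Z)) :
  (forall u v w, f (pure (pure u v) w) = g (pure (pure u v) w)) -> f = g.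
Proof.
move=> fg; apply: tens_ext => t w.
pose k : 'Hom(tens U V, tens (tens U V) W) := linfun (fun t => pure t w).
have kE t' : k t' = pure t' w by rewrite linfunE //; apply: pure_linl.
suff: (f \o k = g \o k)%VF by move/lfunP/(_ t); rewrite !comp_lfunE kE.
by apply: tens_ext => u v; rewrite !comp_lfunE kE fg.
Qed.

Lemma tens_ext3r U V W Z (f g : 'Hom(tens U (tens V W), Z)) :
  (forall u v w, f (pure u (pure v w)) = g (pure u (pure v w))) -> f = g.
Proof.
move=> fg; apply: tens_ext => u t.
pose k : 'Hom(tens V W, tens U (tens V W)) := linfun (fun t => pure u t).
have kE t' : k t' = pure u t' by rewrite linfunE //; apply: pure_linr.
suff: (f \o k = g \o k)%VF by move/lfunP/(_ t); rewrite !comp_lfunE kE.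
by apply: tens_ext => v w; rewrite !comp_lfunE kE fg.
Qed.

Lemma tens_ext4 T U V W Z (f g : 'Hom(tens (tens (tens T U) V) W, Z)) :
  (forall t u v w, f (pure (pure (pure t u) v) w) =
                   g (pure (pure (pure t u) v) w)) -> f = g.
Proof.
move=> fg; apply: tens_ext => s w.
pose k : 'Hom(tens (tens T U) V, tens (tens (tens T U) V) W) :=
  linfun (fun s => pure s w).
have kE s' : k s' = pure s' w by rewrite linfunE //; apply: pure_linl.
suff: (f \o k = g \o k)%VF by move/lfunP/(_ s); rewrite !comp_lfunE kE.
by apply: tens_ext3 => t u v; rewrite !comp_lfunE kE fg.
Qed.

Let ev := (comp_lfunE, id_lfunE, tens_mapE, tens_assocE, tens_lunitE,
  tens_runitE, tens_braidE, dualmapE, tens_curryE).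

Definition FVec_cat : category :=
  @Category (vectType K) (fun V W => 'Hom(V, W)) (fun V => \1%VF)
    (fun U V W g f => (g \o f)%VF)
    (fun _ _ _ _ h g f => comp_lfunA h g f)
    (fun _ _ f => comp_lfun1l f) (fun _ _ f => comp_lfun1r f).

Fact tens_map_id V W : tens_map (\1%VF : 'End(V)) (\1%VF : 'End(W)) = \1%VF.
Proof. by apply: tens_ext => v w; rewrite !ev. Qed.

Fact tens_map_comp V W V' W' V'' W'' (f' : 'Hom(V', V'')) (f : 'Hom(V, V'))
    (g' : 'Hom(W', W'')) (g : 'Hom(W, W')) :
  tens_map (f' \o f)%VF (g' \o g)%VF = (tens_map f' g' \o tens_map f g)%VF.
Proof. by apply: tens_ext => v w; rewrite !ev. Qed.

Fact tens_assoc_nat U V W U' V' W'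
    (f : 'Hom(U, U')) (g : 'Hom(V, V')) (h : 'Hom(W, W')) :
  (tens_assoc U' V' W' \o tens_map (tens_map f g) h =
   tens_map f (tens_map g h) \o tens_assoc U V W)%VF.
Proof. by apply: tens_ext3 => u v w; rewrite !ev. Qed.

Fact tens_lunit_nat V W (f : 'Hom(V, W)) :
  (tens_lunit W \o tens_map \1 f = f \o tens_lunit V)%VF.
Proof. by apply: tens_ext => k v; rewrite !ev linearZ. Qed.

Fact tens_runit_nat V W (f : 'Hom(V, W)) :
  (tens_runit W \o tens_map f \1 = f \o tens_runit V)%VF.
Proof. by apply: tens_ext => v k; rewrite !ev linearZ. Qed.

Fact tens_braid_nat V W V' W' (f : 'Hom(V, V')) (g : 'Hom(W, W')) :
  (tens_braid V' W' \o tens_map f g = tens_map g f \o tens_braid V W)%VF.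
Proof. by apply: tens_ext => v w; rewrite !ev. Qed.

Fact tens_braid_sym V W : (tens_braid W V \o tens_braid V W = \1)%VF.
Proof. by apply: tens_ext => v w; rewrite !ev. Qed.

Fact tens_pentagon T U V W :
  (tens_assoc T U (tens V W) \o tens_assoc (tens T U) V W =
   tens_map \1 (tens_assoc U V W) \o tens_assoc T (tens U V) W
     \o tens_map (tens_assoc T U V) \1)%VF.
Proof. by apply: tens_ext4 => t u v w; rewrite !ev. Qed.

Fact tens_triangle V W :
  (tens_map \1 (tens_lunit W) \o tens_assoc V K^o W =
   tens_map (tens_runit V) \1)%VF.
Proof.
apply: tens_ext3 => v k w; rewrite !ev.
by rewrite (linear_scale (pure_linr v)) (linear_scale (pure_linl w)).
Qed.

Fact tens_hexagon U V W :
  (tens_assoc V W U \o tens_braid U (tens V W) \o tens_assoc U V W =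
   tens_map \1 (tens_braid U W) \o tens_assoc V U W
     \o tens_map (tens_braid U V) \1)%VF.
Proof. by apply: tens_ext3 => u v w; rewrite !ev. Qed.

Fact tens_assoc_iso U V W : @is_iso FVec_cat _ _ (tens_assoc U V W).
Proof.
pose g : 'Hom(tens U (tens V W), tens (tens U V) W) :=
  (tens_braid W (tens U V) \o tens_map \1 (tens_braid V U)
   \o tens_assoc W V U \o tens_map (tens_braid V W) \1
   \o tens_braid U (tens V W))%VF.
exists g; rewrite /= /g; split.
  by apply: tens_ext3 => u v w; rewrite !ev.
by apply: tens_ext3r => u v w; rewrite !ev.
Qed.

Fact tens_lunit_iso V : @is_iso FVec_cat _ _ (tens_lunit V).
Proof.
pose g : 'Hom(V, tens K^o V) := linfun (fun v => pure (1 : K^o) v).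
have gE v : g v = pure (1 : K^o) v by rewrite linfunE //; apply: pure_linr.
exists g; split; last by apply/lfunP=> v; rewrite !ev gE ev scale1r.
apply: tens_ext => k v; rewrite !ev gE (linear_scale (pure_linr _)).
by rewrite -(linear_scale (pure_linl _)) /GRing.scale /= mulr1.
Qed.

Fact tens_runit_iso V : @is_iso FVec_cat _ _ (tens_runit V).
Proof.
pose g : 'Hom(V, tens V K^o) := linfun (fun v => pure v (1 : K^o)).
have gE v : g v = pure v (1 : K^o) by rewrite linfunE //; apply: pure_linl.
exists g; split; last by apply/lfunP=> v; rewrite !ev gE ev scale1r.
apply: tens_ext => v k; rewrite !ev gE (linear_scale (pure_linl _)).
by rewrite -(linear_scale (pure_linr _)) /GRing.scale /= mulr1.
Qed.

Definition FVec_sm : sym_monoidal :=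
  @SymMonoidal FVec_cat tens K^o
    (fun _ _ _ _ f g => tens_map f g) tens_assoc tens_lunit tens_runit tens_braid
    tens_map_id (fun _ _ _ _ _ _ f' f g' g => tens_map_comp f' f g' g)
    (fun _ _ _ _ _ _ f g h => tens_assoc_nat f g h)
    (fun _ _ f => tens_lunit_nat f) (fun _ _ f => tens_runit_nat f)
    (fun _ _ _ _ f g => tens_braid_nat f g)
    tens_assoc_iso tens_lunit_iso tens_runit_iso
    tens_pentagon tens_triangle tens_hexagon
    (fun V W => tens_braid_sym V W).

Fact dualmap_id V : dualmap \1%VF = \1%VF :> 'Hom(dualv V, dualv V).
Proof. by apply/lfunP=> phi; apply/lfunP=> v; rewrite !ev. Qed.

Fact dualmap_comp U V W (g : 'Hom(V, W)) (f : 'Hom(U, V)) :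
  dualmap (g \o f)%VF = (dualmap f \o dualmap g)%VF.
Proof. by apply/lfunP=> phi; apply/lfunP=> v; rewrite !ev. Qed.

Fact tens_curry_nat U V W U' V' W' (f : 'Hom(U', U)) (g : 'Hom(V', V))
    (h : 'Hom(W, W')) (phi : 'Hom(tens U V, W)) :
  tens_curry (h \o phi \o tens_map f g)%VF =
  (dualmap (tens_map g (dualmap h)) \o tens_curry phi \o f)%VF.
Proof.
by apply/lfunP=> u; apply: tens_ext => v psi; rewrite !ev.
Qed.

Definition FVec : star_autonomous :=
  @StarAutonomous FVec_sm dualv (fun _ _ f => dualmap f)
    dualmap_id (fun _ _ _ g f => dualmap_comp g f) dualmap_bij
    (fun _ _ _ f => tens_curry f) tens_curry_bij
    (fun _ _ _ _ _ _ f g h phi => tens_curry_nat f g h phi).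

End Tensor.

Arguments FVec K : clear implicits.

(* The topology of a finite-dimensional space is transported from the product
   topology on R^n along the coordinates in a basis; it does not depend on the
   choice of the basis. *)
Section Cones.
Variables (R : realType) (V : vectType R).
Implicit Types A : set V.

Definition coords A : set 'rV[R]_(\dim {:V}) := passmx.vecof (vbasis {:V}) @^-1` A.

Definition fd_closed A : Prop := closed (coords A).

Definition fd_interior A : set V :=
  passmx.rVof (vbasis {:V}) @^-1` (coords A)^°.

Definition convex_cone A : Prop :=
  [/\ A !=set0, (forall v w, A v -> A w -> A (v + w)) &
      (forall (k : R) v, 0 <= k -> A v -> A (k *: v))].

Definition closed_convex_cone A : Prop := convex_cone A /\ fd_closed A.

Definition sharp A : Prop := A `&` [set - v | v in A] = [set 0].

End Cones.

Section Stem.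
Variable R : realType.

Definition stem (C : star_autonomous) := star_functor C (FVec R).

Variables (C : star_autonomous) (S : stem C).

Definition sobj (c : C) : vectType R := fobj S c.

Definition smap (a b : C) (f : hom a b) : 'Hom(sobj a, sobj b) := fmap S f.

Definition smu (a b : C) : 'Hom(tens (sobj a) (sobj b), sobj (a \ox b)) :=
  fmu S a b.

(* The identification S(1^* ) = S(1)' = R' = R: x is sent to the value of the
   functional [fstar x] at the image of 1 in S(1). *)
Definition dual_unit_val (x : sobj (star unit1)) : R :=
  ((fstar S unit1 : 'Hom(sobj (star unit1), dualv (sobj unit1))) x)
    ((feps S : 'Hom(R^o, sobj unit1)) 1).

Definition Acone (c : C) : set (sobj c) :=
  [set v | forall phi : hom c (star unit1), 0 <= dual_unit_val (smap phi v)].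

Definition cone_family (X : vectType R) := forall e : C, set (tens X (sobj e)).

Definition is_ssystem (X : vectType R) (G : cone_family X) : Prop :=
  (forall e, closed_convex_cone (G e)) /\
  (forall (e f : C) (Phi : hom e f),
     tens_map \1%VF (smap Phi) @` G e `<=` G f).

Definition CP (X Y : vectType R) (G : cone_family X) (E : cone_family Y) :
    set 'Hom(X, Y) :=
  [set Psi | forall e, tens_map Psi \1%VF @` G e `<=` E e].

(* A(d \otimes e) as a subset of S(d) \otimes S(e) *)
Definition intrinsic (d : C) : cone_family (sobj d) :=
  fun e => smu d e @^-1` @Acone (d \ox e).

Definition pullback (X Y : vectType R) (Theta : 'Hom(X, Y)) (E : cone_family Y) :
    cone_family X :=
  fun e => tens_map Theta \1%VF @^-1` E e.

End Stem.

Arguments sobj {R C} S c.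
Arguments smap {R C} S {a b} f.
Arguments Acone {R C} S c.
Arguments cone_family {R C} S X.
Arguments is_ssystem {R C S X} G.
Arguments CP {R C S X Y} G E.
Arguments intrinsic {R C} S d.
Arguments pullback {R C S X Y} Theta E.

(* Main.v *)
Require Import Defs.
From mathcomp Require Import ring lra.
From mathcomp Require Import all_boot all_order all_algebra.
From mathcomp Require Import all_classical all_reals all_analysis.
Import Defs.

Set Implicit Arguments.
Unset Strict Implicit.
Unset Printing Implicit Defensive.

Import Order.TTheory GRing.Theory Num.Theory.
Import numFieldNormedType.Exports.

Local Open Scope ring_scope.
Local Open Scope classical_set_scope.

(** The theorem is an extension theorem for positive functionals in disguise.
    A linear map F from X to S(d) is the same thing as a linear functional on
    the tensor product of X with S(d^* ), namely the one sending x (x) y to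
    the value of y at F x ([dual_pairing], [dual_pairing_surj]).

    Under this correspondence, complete positivity is tested at the single
    object e = d^* .  If F lies in CP(G, A_d), then its functional is
    nonnegative on the cone G(d^* ), because S of the evaluation morphism from
    d (x) d^* to 1^* is the evaluation pairing ([CP_pairing_ge0]).  For
    G = A_c the converse holds as well ([pairing_ge0_CP]): every morphism from
    d (x) e to 1^* transposes to a morphism from e to d^* , along which
    the cone A_c(e) is carried into A_c(d^* ).

    Let K = A_c(d^* ) and N = Theta (x) id.  The map Psi gives a functional
    on X (x) S(d^* ) that is nonnegative on G(d^* ), the preimage of K under
    N, and a Phi as required is a functional that extends it along N
    and is nonnegative on K.  By M. Riesz such an extension exists
    as soon as K together with the image of N fills the whole space
    ([riesz_extension]).  This is clear when Theta is onto.  In the other case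
    the image of N contains an order unit of K: the tensor v0 (x) p, where v0
    is a point of the image of Theta interior to A(c) and p is an order unit of
    the dual cone of A(d), which exists because A(d) is sharp
    ([sharp_dual_order_unit], [intrinsic_order_unit]).

    A stem preserves neither a chosen evaluation morphism nor the braiding by
    definition, only the currying bijection.  Evaluation and transposition are
    therefore built from currying and from the canonical isomorphism of an
    object with its bidual ([bidual], [bidual_iso]), whose image under S is
    the canonical map into the bidual space ([sdual_bidual]). *)

(** * Convex cones and extension of positive functionals *)

Section Cones.
Variable R : realType.
Implicit Types E V W X Y : vectType R.

Lemma cone0 V (K : set V) : convex_cone K -> K 0.
Proof. by move=> [[v Kv] _ /(_ 0 v (lexx 0) Kv)]; rewrite scale0r. Qed.

(** The residue of projecting onto [U] kills [U] and not [e], so some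
    coordinate of it does the same. *)
Lemma functional_separating V (U : {vspace V}) (e : V) : e \notin U ->
  exists2 p : dualv V, (forall u, u \in U -> p u = 0) & p e = 1.
Proof.
move=> eU; pose q : 'End(V) := (\1 - projv U)%VF.
have qE v : q v = v - projv U v by rewrite !lfun_simp.
have qU u : u \in U -> q u = 0 by move=> uU; rewrite qE projv_id // subrr.
have qe : q e != 0.
  rewrite qE subr_eq0; apply: contra eU => /eqP ->; exact: memv_proj.
have [i qei] : exists i, (dualb i : dualv V) (q e) != 0.
  apply/existsP; apply: contraR qe => /existsPn h.
  rewrite [q e]dualbE big1 // => i _; have := h i.
  by rewrite negbK => /eqP ->; rewrite scale0r.
pose p : dualv V := (((dualb i : dualv V) (q e))^-1 *: (dualb i \o q))%VF.
exists p => [u uU|]; rewrite /p scale_lfunE comp_lfunE.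
  by rewrite (qU u) // linear0 scaler0.
exact: mulVf.
Qed.

(** The value of the extension at [e] may be any number between the lower
    bounds [- g u], for [e + u] in [K], and the upper bounds [g u], for [u - e]
    in [K].  A lower bound never exceeds an upper bound, since the sum of the
    two witnesses lies in [K] and in [U], where [g] is nonnegative.  The last
    hypothesis provides bounds of both kinds. *)
Lemma extension_step E (K : set E) (U : {vspace E}) (g : dualv E) (e : E) :
  convex_cone K -> (forall u, u \in U -> K u -> 0 <= g u) ->
  (forall t, exists2 u, u \in U & K (t + u)) ->
  exists2 h : dualv E, (forall u, u \in U -> h u = g u) &
    forall t, t \in (U + <[e]>)%VS -> K t -> 0 <= h t.
Proof.
move=> [_ Kadd Kscale] gK UK.
have [eU|eU] := boolP (e \in U).
  have /addv_idPl -> : (<[e]> <= U)%VS by rewrite -memvE.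
  by exists g.
have [p pU pe] := functional_separating eU.
(* The lower bounds that the values of [g] impose on the value at [e]. *)
pose B : set R := [set r | exists u, [/\ u \in U, K (e + u) & r = - g u]].
have ubB u : u \in U -> K (u - e) -> ubound B (g u).
  move=> uU Ku _ [v [vU Kv ->]].
  rewrite -subr_ge0 opprK -linearD gK ?memvD//.
  by have := Kadd _ _ Ku Kv; rewrite addrA subrK.
have hsB : has_sup B.
  split; first by have [u uU Ku] := UK e; exists (- g u), u.
  have [u uU Ku] := UK (- e); exists (g u); apply: ubB => //.
  by rewrite addrC.
pose h : dualv E := (g + (sup B - g e) *: p)%VF.
have hE t : h t = g t + (sup B - g e) * p t by rewrite add_lfunE scale_lfunE.
have hU u : u \in U -> h u = g u by move=> uU; rewrite hE pU // mulr0 addr0.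
have he : h e = sup B by rewrite hE pe mulr1 addrC subrK.
exists h => // _ /memv_addP[u uU [_ /vlineP[s ->] ->]] Kt.
have -> : h (u + s *: e) = g u + s * sup B by rewrite linearD linearZ /= hU // he.
have [s0|s0|s0] := ltrgtP s 0; last by
  move: Kt; rewrite s0 scale0r mul0r !addr0; exact: gK.
- have ns0 : 0 < - s by rewrite oppr_gt0.
  have : sup B <= g ((- s)^-1 *: u).
    apply: (ge_sup hsB.1); apply: ubB; first exact: memvZ.
    have := Kscale (- s)^-1 _ _ Kt.
    rewrite scalerDr scalerA invrN mulNr mulVf ?lt_eqF// scaleN1r.
    by apply; rewrite oppr_ge0 invr_le0 ltW.
  rewrite linearZ /= /GRing.scale /= -(ler_pM2l ns0) mulrA mulfV ?gt_eqF// mul1r.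
  by rewrite mulNr; lra.
- have : - g (s^-1 *: u) <= sup B.
    apply: (sup_upper_bound hsB).
    exists (s^-1 *: u); split=> //; first exact: memvZ.
    have := Kscale s^-1 _ _ Kt.
    rewrite scalerDr scalerA mulVf ?gt_eqF// scale1r addrC.
    by apply; rewrite invr_ge0 ltW.
  rewrite linearZ /= /GRing.scale /= -(ler_pM2l s0).
  rewrite mulrN mulrA mulfV ?gt_eqF// mul1r.
  by lra.
Qed.

(** The functional descends to the image of [N], because it is both nonnegative
    and nonpositive on the kernel; from there it is extended one basis vector
    at a time. *)
Lemma riesz_extension E Y (K : set E) (N : 'Hom(Y, E)) (f : dualv Y) :
  convex_cone K -> (forall y, K (N y) -> 0 <= f y) ->
  (forall t, exists y, K (t + N y)) ->
  exists2 L : dualv E, f = (L \o N)%VF & forall t, K t -> 0 <= L t.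
Proof.
move=> cK fK NK.
have fker y : N y = 0 -> f y = 0.
  move=> Ny; apply/eqP; rewrite eq_le fK ?Ny; last exact: cone0.
  by rewrite -oppr_ge0 -linearN fK // linearN /= Ny oppr0; exact: cone0.
pose g : dualv E := (f \o N^-1)%VF.
have gN y : g (N y) = f y.
  rewrite comp_lfunE; apply/eqP; rewrite -subr_eq0 -linearB; apply/eqP/fker.
  by rewrite linearB /= limg_lfunVK ?subrr// memv_img// memvf.
have [L LN LK] : exists2 h : dualv E, (forall y, h (N y) = f y) &
    forall t, t \in (limg N + <<vbasis {:E}>>)%VS -> K t -> 0 <= h t.
  elim: (tval (vbasis {:E})) => [|e s [h hN hK]].
    exists g => // t; rewrite span_nil addv0 => /memv_imgP[y _ ->].
    by rewrite gN; exact: fK.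
  have [|h' h'h h'K] := extension_step e cK hK.
    move=> t; have [y Ky] := NK t; exists (N y) => //.
    by rewrite (subvP (addvSl _ _))// memv_img// memvf.
  exists h' => [y|t]; last first.
    by rewrite span_cons [(<[e]> + _)%VS]addvC addvA; exact: h'K.
  by rewrite h'h ?hN// (subvP (addvSl _ _))// memv_img// memvf.
exists L => [|t]; first by apply/lfunP=> y; rewrite comp_lfunE LN.
by apply: LK; rewrite (subvP (addvSr _ _))// (span_basis (vbasisP _)) memvf.
Qed.

Definition order_unit V (K : set V) (e : V) : Prop :=
  forall v, exists2 k : R, 0 <= k & K (v + k *: e).

Lemma order_unit_sym V (K : set V) (e v : V) :
  convex_cone K -> K e -> order_unit K e ->
  exists k : R, [/\ 0 <= k, K (v + k *: e) & K (- v + k *: e)].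
Proof.
move=> [_ Kadd Kscale] Ke Kunit.
have [[k k0 Kk] [l l0 Kl]] := (Kunit v, Kunit (- v)).
exists (k + l); split; first exact: addr_ge0.
  by rewrite scalerDl addrA; apply: Kadd => //; exact: Kscale.
by rewrite [k + l]addrC scalerDl addrA; apply: Kadd => //; exact: Kscale.
Qed.

(** In finite dimension a separating cone of functionals contains finitely many
    that already separate points, and their sum is an order unit.  The proof
    adds one functional at a time, so that the common kernel [Z] of those
    already chosen shrinks to 0, and maintains that every functional vanishing
    on [Z] can be absorbed. *)
Lemma dual_cone_order_unit V (D : set (dualv V)) : convex_cone D ->
  (forall v, (forall p, D p -> p v = 0) -> v = 0) ->
  exists2 e, D e & order_unit D e.
Proof.
move=> cD sepD.
pose unit_off (Z : {vspace V}) := exists2 e, D e & forall q : dualv V,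
  (forall z, z \in Z -> q z = 0) -> exists2 k : R, 0 <= k & D (q + k *: e).
suff shrink n (Z : {vspace V}) : (\dim Z <= n)%N -> unit_off Z -> unit_off 0%VS.
  have [|e De eD] := shrink _ fullv (leqnn _).
  - exists 0 => [|q q0]; first exact: cone0.
    exists 0 => //; rewrite scaler0 addr0 (_ : q = 0); first exact: cone0.
    by apply/lfunP=> v; rewrite q0 ?memvf// zero_lfunE.
  - exists e => // q; apply: eD => z; rewrite memv0 => /eqP ->.
    exact: linear0.
elim: n Z => [|n IHn] Z.
  by rewrite leqn0 dimv_eq0 => /eqP ->.
move=> dimZ unitZ.
have [Z0|Z0] := eqVneq Z 0%VS; first by rewrite -Z0.
pose z := vpick Z.
have zZ : z \in Z := memv_pick Z.
have z0 : z != 0 by rewrite vpick0.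
(* Adding to the chosen functionals one that does not kill [z] shrinks [Z]. *)
have [p Dp pz] : exists2 p, D p & p z != 0.
  apply: contrapT => h; move/negP: z0; apply; apply/eqP/sepD => p Dp.
  by apply: contrapT => /eqP pz; apply: h; exists p.
apply: (IHn (Z :&: lker p)%VS).
  rewrite -ltnS (leq_trans _ dimZ)// ltnNge; apply: contra pz => le.
  have /eqP ZE : (Z :&: lker p == Z)%VS by rewrite eqEdim capvSl.
  by move: zZ; rewrite -ZE memv_cap memv_ker => /andP[].
have [[e De eD] [_ Dadd Dscale]] := (unitZ, cD).
exists (e + p) => [|q qZ]; first exact: Dadd.
(* With this [a], the functional [q - a *: p] vanishes at [z], hence on [Z]. *)
pose a : R := q z / p z.
have [|k k0 Dk] := eD (q - a *: p)%R.
  move=> v vZ; rewrite add_lfunE opp_lfunE scale_lfunE.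
  have : q (v - (p v / p z : R) *: z) = 0.
    apply: qZ; rewrite memv_cap memvB ?memvZ//= memv_ker linearB linearZ /=.
    by rewrite /GRing.scale /= divfK// subrr.
  rewrite linearB linearZ /= /GRing.scale /= => /subr0_eq ->.
  by rewrite /a; field.
exists (k + `|a|); first exact: addr_ge0.
rewrite (_ : q + _ = (q - a *: p + k *: e) + (`|a| *: e + (k + (a + `|a|)) *: p)).
  apply/Dadd/Dadd => //; apply/Dscale => //.
  by rewrite addr_ge0// -lerBlDl sub0r -normrN ler_norm.
apply/lfunP=> v.
by rewrite !(add_lfunE, scale_lfunE, opp_lfunE) /GRing.scale /=; ring.
Qed.

Lemma fd_interior_sub V (K : set V) v : fd_interior K v -> K v.
Proof. by move=> /interior_subset; rewrite /coords /= passmx.rVofK // vbasisP. Qed.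

(** A segment starting at an interior point of [K] remains in [K] for some time. *)
Lemma interior_order_unit V (K : set V) (e : V) :
  fd_interior K e -> convex_cone K -> order_unit K e.
Proof.
move=> Ke [_ _ Kscale] v.
pose b := vbasis {:V}.
have : \forall t \near (0 : R), coords K (passmx.rVof b e + t *: passmx.rVof b v).
  have : (fun t : R => passmx.rVof b e + t *: passmx.rVof b v) @ 0 -->
      passmx.rVof b e + 0 *: passmx.rVof b v.
    apply: cvgD; first exact: cvg_cst.
    by apply: cvgZr_tmp; exact: cvg_id.
  by rewrite scale0r addr0; exact.
have bE t : coords K (passmx.rVof b e + t *: passmx.rVof b v) -> K (e + t *: v).
  by rewrite /coords /= addrC -passmx.rVof_linear addrC passmx.rVofK // vbasisP.
move=> /nbhs_ballP [r /= r0 /(_ (r / 2))] Kr.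
have {}Kr : K (e + (r / 2) *: v).
  apply/bE/Kr; rewrite /ball /= sub0r normrN gtr0_norm ?divr_gt0//.
  by rewrite ltr_pdivrMr// ltr_pMr// ltr1n.
exists (r / 2)^-1; first by rewrite invr_ge0 divr_ge0 // ltW.
have := Kscale (r / 2)^-1 _ _ Kr; rewrite scalerDr scalerA mulVf ?scale1r.
  by rewrite addrC; apply; rewrite invr_ge0 divr_ge0 // ltW.
by rewrite gt_eqF// divr_gt0.
Qed.

(** The vectors that can be brought into [K] by the image of [N] are closed
    under addition, and pure tensors span. *)
Lemma absorbing_pure V W Y (K : set (tens V W)) (N : 'Hom(Y, tens V W)) :
  convex_cone K -> (forall v w, exists z, K (pure v w + N z)) ->
  forall t, exists z, K (t + N z).
Proof.
move=> cK KN t; have [_ Kadd _] := cK; rewrite [t]tens_sum.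
elim/big_ind: _ => [|t1 t2 [z1 K1] [z2 K2]|i _] /=; last exact: KN.
  by exists 0; rewrite linear0 addr0; exact: cone0.
by exists (z1 + z2); rewrite linearD addrACA; exact: Kadd.
Qed.

End Cones.

(** * The bidual in a star autonomous category *)

Local Open Scope cat_scope.

Section StarAutonomous.
Variable C : star_autonomous.
Implicit Types a b c : C.

Definition lunitV a : hom a (unit1 \ox a) := sval (cid (lunit_iso a)).
Definition runitV a : hom a (a \ox unit1) := sval (cid (runit_iso a)).

Lemma lunitVK a : lunitV a \oc lunit a = idc (unit1 \ox a).
Proof. by rewrite /lunitV; case: cid => g []. Qed.

Lemma lunitK a : lunit a \oc lunitV a = idc a.
Proof. by rewrite /lunitV; case: cid => g []. Qed.

Lemma runitVK a : runitV a \oc runit a = idc (a \ox unit1).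
Proof. by rewrite /runitV; case: cid => g []. Qed.

Lemma runitK a : runit a \oc runitV a = idc a.
Proof. by rewrite /runitV; case: cid => g []. Qed.

(** Currying the unitor of [a] lands in the dual of [unit1 \ox star a], which
    the other unitor identifies with the bidual of [a]. *)
Definition bidual a : hom a (star (star a)) :=
  starh (lunitV (star a)) \oc scurry (runit a).

(** Composition with [scurry (runit b)] is, up to the unitor, the currying
    bijection, and hence itself bijective; this is the Yoneda argument behind
    [bidual_iso]. *)
Lemma scurry_runit_comp a b (g : hom a b) :
  scurry (g \oc runit a) = scurry (runit b) \oc g.
Proof.
rewrite -runit_nat -[runit b \oc _]comp1c compcA scurry_nat.
have -> : starh (idc b) = idc (star b) by exact: starh_id.
by rewrite otimesh_id starh_id comp1c.
Qed.

Lemma bidual_iso a : is_iso (bidual a).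
Proof.
suff [h [hk kh]] : is_iso (scurry (runit a)).
  exists (h \oc starh (lunit (star a))); rewrite /bidual; split.
    rewrite compcA -[h \oc _ \oc _]compcA -starh_comp lunitVK starh_id.
    by rewrite compc1.
  rewrite compcA -[_ \oc _ \oc h]compcA kh compc1 -starh_comp lunitK.
  exact: starh_id.
have [s sK Ks] := scurry_bij (star (unit1 \ox star a)) unit1 a.
pose h := s (idc _) \oc runitV _.
have kh : scurry (runit a) \oc h = idc _.
  by rewrite -scurry_runit_comp /h -compcA runitVK compc1 Ks.
exists h; split=> //.
have /bij_inj inj := scurry_bij a unit1 a.
have : scurry ((h \oc scurry (runit a)) \oc runit a) = scurry (runit a).
  by rewrite scurry_runit_comp compcA kh comp1c.
move=> /inj /(congr1 (fun f => f \oc runitV a)).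
by rewrite -compcA runitK compc1.
Qed.

End StarAutonomous.

(** * Stems: evaluation and transposition *)

Section Stem.
Variables (R : realType) (C : star_autonomous) (S : stem R C).
Implicit Types a b c d e : C.

Definition sdual a : 'Hom(sobj S (star a), dualv (sobj S a)) := fstar S a.
Definition unit_elt : sobj S unit1 := (feps S : 'Hom(R^o, sobj S unit1)) 1.

Lemma smap_id a : smap S (idc a) = \1%VF.
Proof. exact (fmap_id S a). Qed.

Lemma smap_comp a b c (g : hom b c) (f : hom a b) v :
  smap S (g \oc f) v = smap S g (smap S f v).
Proof.
have -> : smap S (g \oc f) = (smap S g \o smap S f)%VF by exact (fmap_comp S g f).
by rewrite comp_lfunE.
Qed.

Lemma smuE a b a' b' (f : hom a a') (g : hom b b') t :
  smu S a' b' (tens_map (smap S f) (smap S g) t) = smap S (f \ot g) (smu S a b t).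
Proof. by have /lfunP/(_ t) := fmu_nat S f g; rewrite !comp_lfunE. Qed.

Lemma sdual_nat a b (f : hom a b) x v :
  sdual a (smap S (starh f) x) v = sdual b x (smap S f v).
Proof.
have /lfunP/(_ x)/lfunP/(_ v) := fstar_nat S f.
by rewrite !comp_lfunE dualmapE.
Qed.

Lemma smu_lunit a x : smap S (lunit a) (smu S unit1 a (pure unit_elt x)) = x.
Proof.
have /lfunP/(_ (pure (1 : R^o) x)) := fmu_lunit S a.
by rewrite !comp_lfunE tens_mapE tens_lunitE id_lfunE scale1r.
Qed.

Lemma smu_runit a x : smap S (runit a) (smu S a unit1 (pure x unit_elt)) = x.
Proof.
have /lfunP/(_ (pure x (1 : R^o))) := fmu_runit S a.
by rewrite !comp_lfunE tens_mapE tens_runitE id_lfunE scale1r.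
Qed.

(** Preservation of currying, evaluated at vectors.  All the other facts about
    evaluation are derived from this one. *)
Lemma sdual_scurry a b c (f : hom (a \ox b) c) v w z :
  sdual (b \ox star c) (smap S (scurry f) v) (smu S b (star c) (pure w z)) =
  sdual c z (smap S f (smu S a b (pure v w))).
Proof.
have /lfunP/(_ v)/lfunP/(_ (pure w z)) := fstar_scurry S f.
rewrite !comp_lfunE !dualmapE tens_mapE id_lfunE.
by rewrite tens_curryE comp_lfunE.
Qed.

Lemma sdual_inv a : exists g : 'Hom(dualv (sobj S a), sobj S (star a)),
  (forall x, g (sdual a x) = x) /\ (forall p, sdual a (g p) = p).
Proof.
have [g [gK Kg]] := fstar_iso S a; exists g; split=> x.
  by have /lfunP/(_ x) := gK; rewrite comp_lfunE id_lfunE.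
by have /lfunP/(_ x) := Kg; rewrite comp_lfunE id_lfunE.
Qed.

Lemma smap_lunitV a x : smap S (lunitV a) x = smu S unit1 a (pure unit_elt x).
Proof. by rewrite -{1}[x]smu_lunit -smap_comp lunitVK smap_id id_lfunE. Qed.

Lemma smap_runitV a x : smap S (runitV a) x = smu S a unit1 (pure x unit_elt).
Proof. by rewrite -{1}[x]smu_runit -smap_comp runitVK smap_id id_lfunE. Qed.

(** The image of [bidual] under S is the canonical map of a space into its
    bidual, which is why the two unit vectors cancel against the unitors. *)
Lemma sdual_bidual a v x : sdual (star a) (smap S (bidual a) v) x = sdual a x v.
Proof.
by rewrite smap_comp sdual_nat smap_lunitV sdual_scurry smu_runit.
Qed.

(** Linearity of [dual_unit_val] is needed in bundled form, to compare functionals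
    on tensors by their values at pure tensors. *)
Definition dual_unit_fun : dualv (sobj S (star unit1)) :=
  linfun (dual_unit_val (S := S) : _ -> R^o).

Lemma dual_unit_funE y : dual_unit_fun y = dual_unit_val y.
Proof.
rewrite linfunE // => k p q.
by rewrite /dual_unit_val linearP add_lfunE scale_lfunE.
Qed.

(** The vector that represents the functional [dual_unit_val]; as it is the image
    of the unit vector under a morphism, tensoring with it can be undone
    inside the category. *)
Definition bidual_unit_elt : sobj S (star (star unit1)) :=
  smap S (bidual unit1) unit_elt.

Lemma sdual_bidual_unit_elt y :
  sdual (star unit1) bidual_unit_elt y = dual_unit_val y.
Proof. by rewrite sdual_bidual. Qed.

Definition tensor_bidual_unit a : hom a (a \ox star (star unit1)) :=
  (idc a \ot bidual unit1) \oc runitV a.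

Lemma smap_tensor_bidual_unit a z :
  smap S (tensor_bidual_unit a) z =
    smu S a (star (star unit1)) (pure z bidual_unit_elt).
Proof.
by rewrite smap_comp smap_runitV -smuE tens_mapE smap_id id_lfunE.
Qed.

Lemma dual_unit_curry a b (f : hom (a \ox b) (star unit1)) v w :
  dual_unit_val (smap S f (smu S a b (pure v w))) =
  sdual b (smap S (starh (tensor_bidual_unit b) \oc scurry f) v) w.
Proof.
rewrite smap_comp sdual_nat smap_tensor_bidual_unit.
by rewrite sdual_scurry sdual_bidual_unit_elt.
Qed.

(** Transposing the curried form of [f] through the bidual exchanges the
    arguments without using the braiding, which S need not preserve. *)
Lemma dual_unit_transpose a b (f : hom (a \ox b) (star unit1)) :
  exists g : hom b (star a), forall v w,
    dual_unit_val (smap S f (smu S a b (pure v w))) = sdual a (smap S g w) v.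
Proof.
exists (starh (starh (tensor_bidual_unit b) \oc scurry f) \oc bidual b) => v w.
by rewrite dual_unit_curry [in RHS]smap_comp sdual_nat sdual_bidual.
Qed.

(** The evaluation morphism is obtained by uncurrying [bidual a]; the inverse of
    the bidual isomorphism at the unit removes the extra tensor factor. *)
Lemma dual_unit_eval a : exists f : hom (a \ox star a) (star unit1),
  forall v x, dual_unit_val (smap S f (smu S a (star a) (pure v x))) = sdual a x v.
Proof.
have [g [gK Kg]] := bidual_iso (unit1 : C).
pose r := runit (star a) \oc (idc (star a) \ot g).
have [s sK Ks] := scurry_bij a (star a) (star (unit1 : C)).
exists (s (starh r \oc bidual a)) => v x.
rewrite -sdual_bidual_unit_elt -sdual_scurry Ks smap_comp sdual_nat sdual_bidual.
rewrite /r smap_comp -smuE tens_mapE smap_id id_lfunE.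
rewrite /bidual_unit_elt -smap_comp gK.
by rewrite smap_id id_lfunE smu_runit.
Qed.

Lemma Acone_cone a : convex_cone (Acone S a).
Proof.
split=> [|v w Av Aw f|k v k0 Av f].
- by exists 0 => f; rewrite -dual_unit_funE !linear0.
- rewrite -dual_unit_funE !linearD /= !dual_unit_funE.
  by apply: addr_ge0; [exact: Av | exact: Aw].
- rewrite -dual_unit_funE !linearZ /= dual_unit_funE.
  by apply: mulr_ge0 => //; exact: Av.
Qed.

Lemma intrinsic_cone d e : convex_cone (intrinsic S d e).
Proof.
have [_ Aadd Ascale] := Acone_cone (d \ox e).
split=> [|t u At Au|k t k0 At]; rewrite /intrinsic /=.
- by exists 0; rewrite /= linear0; exact: cone0 (Acone_cone _).
- by rewrite linearD; exact: Aadd.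
- by rewrite linearZ; exact: Ascale.
Qed.

Lemma Acone_smap a b (f : hom a b) v : Acone S a v -> Acone S b (smap S f v).
Proof. by move=> Av g; rewrite -smap_comp; exact: Av. Qed.

Lemma intrinsic_smap d e e' (f : hom e e') t :
  intrinsic S d e t -> intrinsic S d e' (tens_map \1%VF (smap S f) t).
Proof.
by rewrite /intrinsic /= -(smap_id d) smuE; exact: Acone_smap.
Qed.

(** * Linear maps as functionals, and complete positivity *)

Definition dual_pairing (X : vectType R) d (F : 'Hom(X, sobj S d)) :
    dualv (tens X (sobj S (star d))) :=
  tens_lift (fun x (y : sobj S (star d)) => sdual d y (F x)).

Lemma dual_pairingE (X : vectType R) d (F : 'Hom(X, sobj S d)) x y :
  dual_pairing F (pure x y) = sdual d y (F x).
Proof.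
rewrite tens_liftE //; split=> [v k p q|w k p q]; last by rewrite !linearP.
by rewrite linearP add_lfunE scale_lfunE.
Qed.

Lemma dual_pairing_surj (X : vectType R) d (L : dualv (tens X (sobj S (star d)))) :
  exists F : 'Hom(X, sobj S d), L = dual_pairing F.
Proof.
have [g [gK Kg]] := sdual_inv d.
pose b := vbasis {:sobj S d}.
pose f x := \sum_(i < \dim {:sobj S d}) (L (pure x (g (dualb i))) : R) *: b`_i.
have fl : linear f.
  move=> k x y; rewrite /f scaler_sumr -big_split /=; apply: eq_bigr => i _.
  by rewrite (pure_linl (g (dualb i))) linearP scalerA -scalerDl.
exists (linfun f); apply: tens_ext => x y.
rewrite dual_pairingE linfunE // /f linear_sum.
rewrite -{1}[y]gK [in LHS](dualb_sum (sdual d y)).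
rewrite linear_sum (linear_bigsum _ _ (pure_linr x)) linear_sum.
apply: eq_bigr => i _.
by rewrite linearZ (linear_scale (pure_linr x)) !linearZ /= /GRing.scale /= mulrC.
Qed.

Lemma dual_pairing_inj (X : vectType R) d (F G : 'Hom(X, sobj S d)) :
  dual_pairing F = dual_pairing G -> F = G.
Proof.
move=> FG; have [g [_ Kg]] := sdual_inv d.
apply/lfunP=> x; rewrite [LHS]dualbE [RHS]dualbE; apply: eq_bigr => i _.
by rewrite -[dualb i]Kg -!dual_pairingE FG.
Qed.

Lemma dual_pairing_comp (X Y : vectType R) d (F : 'Hom(Y, sobj S d))
    (T : 'Hom(X, Y)) :
  dual_pairing (F \o T)%VF = (dual_pairing F \o tens_map T \1)%VF.
Proof.
apply: tens_ext => x y.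
by rewrite comp_lfunE tens_mapE !dual_pairingE comp_lfunE id_lfunE.
Qed.

(** The pairing with [F] is the evaluation morphism applied after [F], and
    evaluation is nonnegative on A_d at the dual of [d]. *)
Lemma CP_pairing_ge0 (X : vectType R) (G : cone_family S X) d
    (F : 'Hom(X, sobj S d)) t :
  CP G (intrinsic S d) F -> G (star d) t -> 0 <= dual_pairing F t.
Proof.
move=> FCP Gt; have [f fE] := dual_unit_eval d.
suff -> : dual_pairing F t =
    dual_unit_val (smap S f (smu S d (star d) (tens_map F \1%VF t))).
  by apply: (FCP (star d)); exists t.
rewrite -dual_unit_funE -!comp_lfunE; congr (fun_of_lfun _ _).
apply: tens_ext => x y.
by rewrite !comp_lfunE dual_unit_funE tens_mapE id_lfunE fE dual_pairingE.
Qed.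

(** Moving a test morphism [f] from [d \ox e] to the dual unit over to the
    second factor turns the test of [F] at [e] into the pairing with [F] at the
    dual of [d]. *)
Lemma pairing_ge0_CP c d (F : 'Hom(sobj S c, sobj S d)) :
  (forall t, intrinsic S c (star d) t -> 0 <= dual_pairing F t) ->
  CP (intrinsic S c) (intrinsic S d) F.
Proof.
move=> F0 e _ [t At <-] f; have [g gE] := dual_unit_transpose f.
suff -> : dual_unit_val (smap S f (smu S d e (tens_map F \1%VF t))) =
    dual_pairing F (tens_map \1%VF (smap S g) t).
  by apply: F0; exact: intrinsic_smap.
rewrite -dual_unit_funE -!comp_lfunE; congr (fun_of_lfun _ _).
apply: tens_ext => x y.
by rewrite !comp_lfunE dual_unit_funE !tens_mapE !id_lfunE gE dual_pairingE.
Qed.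

(** * Order units of the intrinsic cone *)

Definition Acone_dual d : set (dualv (sobj S d)) :=
  [set p | forall v, Acone S d v -> 0 <= p v].

Lemma Acone_dual_cone d : convex_cone (Acone_dual (d := d)).
Proof.
split=> [|p q p0 q0 v Av|k p k0 p0 v Av].
- by exists 0 => v _; rewrite zero_lfunE.
- by rewrite add_lfunE addr_ge0 ?p0 ?q0.
- by rewrite scale_lfunE mulr_ge0 ?p0.
Qed.

(** A vector killed by the dual cone is killed by all the functionals that define
    A(d); then it and its opposite lie in A(d), and sharpness makes it 0. *)
Lemma sharp_dual_order_unit d : sharp (Acone S d) ->
  exists2 p, Acone_dual (d := d) p & order_unit (Acone_dual (d := d)) p.
Proof.
move=> sharpA; apply: dual_cone_order_unit; first exact: Acone_dual_cone.
move=> v v0.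
have f0 (f : hom d (star unit1)) : dual_unit_val (smap S f v) = 0.
  have -> : dual_unit_val (smap S f v) = (dual_unit_fun \o smap S f)%VF v.
    by rewrite comp_lfunE dual_unit_funE.
  by apply: v0 => w Aw; rewrite comp_lfunE dual_unit_funE; exact: Aw.
suff : (Acone S d `&` [set - w | w in Acone S d]) v by rewrite sharpA.
split=> [f|]; first by rewrite f0.
exists (- v); last exact: opprK.
by move=> f; rewrite -dual_unit_funE !linearN /= dual_unit_funE f0 oppr0.
Qed.

(** A morphism from [c \ox star d] to the dual unit is, after currying and
    removal of the bidual, a morphism from [c] to [d], which maps A(c) into
    A(d). *)
Lemma intrinsic_pure c d v y : Acone S c v -> Acone_dual (sdual d y) ->
  intrinsic S c (star d) (pure v y).
Proof.
move=> Av Dy f; have [g [_ gK]] := bidual_iso d.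
rewrite dual_unit_curry; set h := starh _ \oc _.
have -> : h = bidual d \oc (g \oc h) by rewrite compcA gK comp1c.
by rewrite smap_comp sdual_bidual; apply/Dy/Acone_smap.
Qed.

(** With v0, y0 scaled so that the vectors v0 + v, v0 - v, y0 + y and y0 - y lie
    in the respective cones, (v0 + v) (x) (y0 + y) + (v0 - v) (x) (y0 - y)
    equals 2 v0 (x) y0 + 2 v (x) y. *)
Lemma intrinsic_order_unit c d v0 y0 :
  Acone S c v0 -> order_unit (Acone S c) v0 ->
  Acone_dual (sdual d y0) -> order_unit (Acone_dual (d := d)) (sdual d y0) ->
  forall v y, exists k : R, intrinsic S c (star d) (pure v y + pure (k *: v0) y0).
Proof.
move=> Av0 v0U Dy0 y0U v y.
have [k [_ kp kn]] := order_unit_sym v (Acone_cone c) Av0 v0U.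
have [l [_ lp ln]] := order_unit_sym (sdual d y) (Acone_dual_cone d) Dy0 y0U.
have [_ Kadd Kscale] := intrinsic_cone c (star d).
have Kp : intrinsic S c (star d) (pure (v + k *: v0) (y + l *: y0)).
  by apply: intrinsic_pure => //; rewrite linearD linearZ.
have Kn : intrinsic S c (star d) (pure (- v + k *: v0) (- y + l *: y0)).
  by apply: intrinsic_pure => //; rewrite linearD linearN linearZ.
exists (k * l).
have := Kscale 2^-1 _ _ (Kadd _ _ Kp Kn).
suff -> : 2^-1 *: (pure (v + k *: v0) (y + l *: y0) +
    pure (- v + k *: v0) (- y + l *: y0)) = pure v y + pure ((k * l) *: v0) y0.
  by apply; rewrite invr_ge0.
apply/lfunP=> p; rewrite [LHS]dualbE [RHS]dualbE; apply: eq_bigr => i _.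
congr (_ *: _); rewrite !(scale_lfunE, add_lfunE, pureE).
rewrite !(linearD, linearN, linearZ) /= !(linearD, linearN, linearZ) /=.
rewrite /GRing.scale /=.
by field.
Qed.

End Stem.

(** * The extension theorem *)

Theorem theorem3p25 (R : realType) (C : star_autonomous) (S : stem R C)
    (c d : C) (X : vectType R) (G : cone_family S X) (Theta : 'Hom(X, sobj S c)) :
  is_ssystem G ->
  G = pullback Theta (intrinsic S c) ->
  (forall y : sobj S c, exists x : X, Theta x = y) \/
  ((exists x : X, fd_interior (Acone S c) (Theta x)) /\ sharp (Acone S d)) ->
  forall Psi : 'Hom(X, sobj S d), CP G (intrinsic S d) Psi ->
  exists2 Phi : 'Hom(sobj S c, sobj S d),
    CP (intrinsic S c) (intrinsic S d) Phi & Psi = (Phi \o Theta)%VF.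
Proof.
move=> _ GE alt Psi PsiCP.
pose N : 'Hom(tens X (sobj S (star d)), _) :=
  tens_map Theta (\1 : 'End(sobj S (star d)))%VF.
have cK := intrinsic_cone S c (star d).
have absorb t : exists z, intrinsic S c (star d) (t + N z).
  apply: absorbing_pure t => // v y.
  case: alt => [onto|[[x0 x0int] sharpA]].
    have [x <-] := onto v; exists (pure (- x) y).
    rewrite tens_mapE id_lfunE -scaleN1r linearZ (linear_scale (pure_linl y)).
    by rewrite scaleN1r subrr; exact: cone0.
  have [p Dp pU] := sharp_dual_order_unit sharpA.
  have [g [_ Kg]] := sdual_inv S d.
  rewrite -(Kg p) in Dp pU.
  have [k Kk] := intrinsic_order_unit (fd_interior_sub x0int)
    (interior_order_unit x0int (Acone_cone S c)) Dp pU v y.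
  by exists (pure (k *: x0) (g p)); rewrite tens_mapE id_lfunE linearZ.
have [L LN L0] := riesz_extension (f := dual_pairing Psi) (N := N) cK
  (fun t Kt => CP_pairing_ge0 PsiCP (t := t) ltac:(by rewrite GE)) absorb.
have [Phi LE] := dual_pairing_surj L.
exists Phi; first by apply: pairing_ge0_CP => t; rewrite -LE; exact: L0.
by apply: dual_pairing_inj; rewrite dual_pairing_comp -LE.
Qed.
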